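(* For any $0<\delta<1$ there exists $c>0$ such that the following holds. Let $A_n$ be a random subset of $[n]=\{1,\dots,n\}$ in which each element is included independently with probability $\delta$. Then the probability that $A_n$ contains a Hilbert cube of dimension at least $c\sqrt{\log n}$ tends to $0$ as $n\to\infty$.
   Context: Logarithms are base $2$. A Hilbert cube of dimension $d$ is a set of the form $H(x_0,x_1,\dots,x_d)=\{x_0+\sum_{i\in I}x_i : I\subseteq[d]\}$, where $x_0$ is a non-negative integer and $x_1,\dots,x_d$ are distinct positive integers. *)

(* Defs.v *)
From HB Require Import structures.
From mathcomp Require Import all_boot all_order all_algebra.
From mathcomp Require Import all_classical all_reals all_analysis.

Set Implicit Arguments.
Unset Strict Implicit.
Unset Printing Implicit Defensive.

Import Order.TTheory GRing.Theory Num.Theory.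
Import numFieldNormedType.Exports.

Local Open Scope classical_set_scope.
Local Open Scope ring_scope.

Definition log2 (R : realType) (x : R) : R := ln x / ln 2.

Definition hilbert_cube (d : nat) (x0 : nat) (x : 'I_d -> nat) : set nat :=
  [set (x0 + \sum_(i in I) x i)%N | I in [set: {set 'I_d}]].

Definition is_hilbert_cube (d : nat) (H : set nat) : Prop :=
  exists (x0 : nat) (x : 'I_d -> nat),
    [/\ forall i, (0 < x i)%N, injective x & H = hilbert_cube x0 x].

(* A subset of [n] = {1, ..., n} is encoded as A : {set 'I_n}, the index
   i : 'I_n standing for the integer i + 1. *)
Definition to_nat_set (n : nat) (A : {set 'I_n}) : set nat :=
  [set (val i).+1 | i in [set i | i \in A]].

(* Mass of A under the product Bernoulli(delta) law on subsets of [n]. *)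
Definition random_subset_weight (R : realType) (delta : R) (n : nat)
    (A : {set 'I_n}) : R :=
  \prod_(i < n) (if i \in A then delta else 1 - delta).

Definition random_subset_prob (R : realType) (delta : R) (n : nat)
    (E : set nat -> Prop) : R :=
  \sum_(A : {set 'I_n} | `[< E (to_nat_set A) >]) random_subset_weight delta A.

Definition contains_cube_of_dim_ge (R : realType) (t : R) (S : set nat) : Prop :=
  exists (d : nat) (H : set nat),
    [/\ t <= d%:R, is_hilbert_cube d H & H `<=` S].

(* Main.v *)
Require Import Defs.
From mathcomp Require Import all_boot all_order all_algebra.
From mathcomp Require Import all_classical all_reals all_analysis.
From mathcomp Require Import zify ring lra.

(** Call y_1, ..., y_8 independent if the sums a_1 y_1 + ... + a_8 y_8 with
    0 <= a_i < q are distinct. A cube of dimension at least c sqrt(log n)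
    contains one with 2k generators, k = 16 q^2 and q of order (log n)^(1/4).
    If every k of the generators contain 8 independent ones, then, as long as
    there are fewer than q^8 / 2 subset sums T of the generators picked so far,
    some unused generator enlarges T by a factor 1 + 1 / (16 q); hence some k
    generators have so many subset sums, at least (q / 8)^8, that a union bound
    over all cubes of dimension k suffices. Otherwise some k generators satisfy
    linear relations with coefficients below q over 7 of them. There are only
    (n + 1)^8 q^(15 k) such cubes, and each has at least k^2 / 2 elements, which
    is a large multiple of log n when c is large. *)

Import Order.TTheory GRing.Theory Num.Theory.
Import numFieldNormedType.Exports.

(** * Distinct subset sums of a list of generators *)

(** When [T] lists the subset sums found so far, this is the number of new ones that a further
    generator [z] creates. *)
Definition escape (T : seq nat) (z : nat) : nat :=
  count (fun t => t + z \notin T) T.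

Fixpoint subset_sums (l : seq nat) : seq nat :=
  if l is x :: l' then
    let T := subset_sums l' in T ++ [seq t + x | t <- T & t + x \notin T]
  else [:: 0].

Lemma subset_sums_uniq (l : seq nat) : uniq (subset_sums l).
Proof.
elim: l => //= x l IH; rewrite cat_uniq IH /= map_inj_uniq; last exact: addIn.
rewrite filter_uniq // andbT; apply/hasPn => _ /mapP[t + ->].
by rewrite mem_filter => /andP[].
Qed.

Lemma size_subset_sums_cons (x : nat) (l : seq nat) :
  size (subset_sums (x :: l)) =
  size (subset_sums l) + escape (subset_sums l) x.
Proof. by rewrite /= size_cat size_map size_filter. Qed.

Lemma mem_subset_sums_cons (x : nat) (l : seq nat) (z : nat) :
  reflect (z \in subset_sums l \/ exists2 t, t \in subset_sums l & z = t + x)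
          (z \in subset_sums (x :: l)).
Proof.
rewrite /= mem_cat; apply: (iffP orP) => [[zl|/mapP[t]]|[zl|[t tl ->]]].
- by left.
- by rewrite mem_filter => /andP[_ tl] ->; right; exists t.
- by left.
- have [tx|tx] := boolP (t + x \in subset_sums l); first by left.
  by right; apply/mapP; exists t; rewrite // mem_filter tx.
Qed.

Lemma subset_sums0 (l : seq nat) : 0 \in subset_sums l.
Proof. by elim: l => // x l IH; apply/mem_subset_sums_cons; left. Qed.

Lemma leq_mem_sumn (l : seq nat) (y : nat) : y \in l -> y <= sumn l.
Proof. by elim: l => //= a l IH; rewrite inE => /orP[/eqP->|/IH]; lia. Qed.

(** Leave out the single generator [y], or nothing when [y] is 0. *)
Lemma subset_sums_sumnB (l : seq nat) (y : nat) :
  y \in 0 :: l -> sumn l - y \in subset_sums l.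
Proof.
elim: l y => [|x l IH] y; first by rewrite inE => /eqP->.
rewrite !inE orbCA => /orP[/eqP->|yl]; apply/mem_subset_sums_cons.
  left; rewrite /= addKn -[sumn l]subn0; apply: IH; exact: mem_head.
right; exists (sumn l - y); first exact: IH.
have: y <= sumn l.
  by move: yl; rewrite -in_cons inE => /orP[/eqP->//|/leq_mem_sumn].
rewrite /=; lia.
Qed.

Lemma subset_sums_le (l : seq nat) (z : nat) :
  z \in subset_sums l -> z <= sumn l.
Proof.
elim: l z => [|x l IH] z; first by rewrite inE => /eqP->.
case/mem_subset_sums_cons => [/IH|[t /IH + ->]] /=; lia.
Qed.

(* If [x] exceeds every element of [l], the sums [sumn l + x - y] with [y] in
   [0 :: l] exceed every subset sum of [l]. *)
Lemma size_subset_sums_sorted (l : seq nat) :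
  sorted gtn l -> 0 \notin l ->
  (size l) ^ 2 <= 2 * size (subset_sums l).
Proof.
have gtn_trans : transitive gtn by move=> a b c /=; lia.
elim: l => // x l IH /= xl; rewrite inE negb_or => /andP[x0 l0].
have {}xl : all (fun y => y < x) l /\ sorted gtn l.
  by move: xl; rewrite path_sortedE // => /andP[].
case: xl => /allP xl lsort.
(* With [s = size l], a gain of s + 1 sums is enough, as (s + 1)^2 <= s^2 + 2 (s + 1). *)
suff : size (0 :: l) <= escape (subset_sums l) x.
  have := IH lsort l0.
  rewrite -/(subset_sums (x :: l)) size_subset_sums_cons /=.
  by rewrite -!mulnn; nia.
rewrite /escape -size_filter -(size_map (fun y => sumn l - y)).
apply: uniq_leq_size.
  rewrite map_inj_in_uniq /=.
    rewrite l0; apply: (sorted_uniq gtn_trans) => //; by move=> a /=; lia.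
  have le y : y \in 0 :: l -> y <= sumn l.
    by rewrite inE => /orP[/eqP->//|/leq_mem_sumn].
  by move=> a b /le + /le; lia.
move=> _ /mapP[y yl ->]; rewrite mem_filter subset_sums_sumnB // andbT.
apply/negP => /subset_sums_le.
have : y < x by move: yl; rewrite inE => /orP[/eqP->|/xl//]; lia.
have : y <= sumn l by move: yl; rewrite inE => /orP[/eqP->//|/leq_mem_sumn].
lia.
Qed.

(** * Subadditivity of [escape], and independent lists *)

Lemma escape0 (T : seq nat) : escape T 0 = 0.
Proof.
apply/eqP; rewrite -leqn0 leqNgt -has_count; apply/hasPn => t tT.
by rewrite addn0 tT.
Qed.

(** If [t + z + w] is outside [T], then either [t + z] is already outside, or [t + z] is an element
    of [T] that escapes under [w]; distinct [t] give distinct such elements. *)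
Lemma escapeD (T : seq nat) (z w : nat) : uniq T ->
  escape T (z + w) <= escape T z + escape T w.
Proof.
move=> uT.
pose P := fun t => (t + z \in T) && (t + z + w \notin T).
have h : escape T (z + w) <= escape T z + count P T.
  rewrite /escape -count_predUI; apply: leq_trans (leq_addr _ _).
  apply: sub_count => t; rewrite /= /P addnA.
  by case: (t + z \in T).
apply: leq_trans h _; rewrite leq_add2l -size_filter -(size_map (addn^~ z)).
rewrite /escape -size_filter; apply: uniq_leq_size.
  by rewrite map_inj_uniq ?filter_uniq //; exact: addIn.
move=> _ /mapP[t + ->]; rewrite !mem_filter /P => /andP[/andP[-> ->]] //.
Qed.

Lemma escapeM (T : seq nat) (a z : nat) : uniq T ->
  escape T (a * z) <= a * escape T z.
Proof.
move=> uT; elim: a => [|a IH]; first by rewrite !mul0n escape0.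
by rewrite !mulSn (leq_trans (escapeD _ _ _ uT)) // leq_add2l.
Qed.

Fixpoint dot (a y : seq nat) : nat :=
  match a, y with
  | a0 :: a', y0 :: y' => a0 * y0 + dot a' y'
  | _, _ => 0
  end.

Lemma escape_dot (T a y : seq nat) (q m : nat) : uniq T ->
  all (ltn^~ q) a -> {in y, forall x, escape T x <= m} ->
  escape T (dot a y) <= size y * (q * m).
Proof.
move=> uT; elim: a y => [|a0 a IH] [|y0 y] /=; rewrite ?escape0 //.
move=> /andP[a0q aq] ym; rewrite mulSn.
apply: leq_trans (escapeD _ _ _ uT) _; apply: leq_add.
  apply: leq_trans (escapeM _ _ _ uT) _; apply: leq_mul; first exact: ltnW.
  by apply: ym; rewrite mem_head.
by apply: IH => // x xy; apply: ym; rewrite inE xy orbT.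
Qed.

Definition independent (q : nat) (y : seq nat) : Prop :=
  forall a b : seq nat, size a = size y -> size b = size y ->
    all (ltn^~ q) a -> all (ltn^~ q) b -> dot a y = dot b y -> a = b.

(* A translate of [T] meets [T] in at least half of it for at most [2 * size T]
   translations, fewer than the box sums of [y]; subadditivity of [escape]
   passes the escape of some box sum on to an element of [y]. *)
Lemma independent_escape (q : nat) (y T : seq nat) : uniq T -> 0 < size T ->
  independent q y -> 2 * size T < q ^ size y ->
  exists2 x, x \in y & size T <= 2 * (size y * q) * escape T x.
Proof.
move=> uT T0 yi Tq; apply: contrapT => noex.
have small x : x \in y -> 2 * (size y * q) * escape T x < size T.
  by move=> xy; rewrite ltnNge; apply/negP => h; apply: noex; exists x.
have half (a : (size y).-tuple 'I_q) :
    size T <= 2 * count (fun t => t + dot (map val a) y \in T) T.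
  have Tsplit := count_predC (fun t => t + dot (map val a) y \in T) T.
  suff : 2 * escape T (dot (map val a) y) <= size T.
    rewrite /escape; rewrite -Tsplit.
    rewrite (eq_count (a2 := predC (fun t => t + dot (map val a) y \in T))) //.
    lia.
  (* The maximum [m] below is attained only for nonempty [y]; for empty [y] the translation is by
     0. *)
  case: y a {yi Tq noex Tsplit} small => [|y0 y] a small.
    by have -> : dot (map val a) [::] = 0; [case: (map _ _)|rewrite escape0].
  have aq : all (ltn^~ q) (map val a).
    by apply/allP => _ /mapP[i _ ->] /=; case: i.
  pose m := \max_(x <- y0 :: y) escape T x.
  have ym : {in y0 :: y, forall x, escape T x <= m}.
    by move=> x xy; rewrite /m (big_rem x) //= leq_maxl.
  have [x xy mx] : exists2 x, x \in y0 :: y & m = escape T x.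
    rewrite /m; elim: y y0 {a small aq m ym} => [|y1 y IH] y0.
      by exists y0; rewrite ?mem_head // big_seq1.
    have [x xy mx] := IH y1; rewrite big_cons mx.
    case: (leqP (escape T y0) (escape T x)) => h.
      by exists x; rewrite // inE xy orbT.
    by exists y0; rewrite ?mem_head.
  have := escape_dot _ _ _ _ _ uT aq ym; have := small x xy; rewrite -mx; lia.
(* Double counting: a pair of elements of [T] fixes the translation, hence by independence the
   vector [a], so all incidences inject into the pairs. *)
have tot : \sum_(a : (size y).-tuple 'I_q)
    count (fun t => t + dot (map val a) y \in T) T <= size T * size T.
  under eq_bigr do rewrite -size_filter.
  pose pairs := [seq (t, t + dot (map val a) y) |
     a : (size y).-tuple 'I_q <- enum {: (size y).-tuple 'I_q},
     t : nat <- [seq t <- T | t + dot (map val a) y \in T]].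
  have <- : size pairs = \sum_(a : (size y).-tuple 'I_q)
      size [seq t <- T | t + dot (map val a) y \in T].
    rewrite size_allpairs_dep sumnE big_map big_enum //.
  rewrite -(size_allpairs pair); apply: uniq_leq_size.
    apply: allpairs_uniq_dep; first exact: enum_uniq.
      by move=> a _; rewrite filter_uniq.
    move=> [a t] [b u] _ _ /= [tu]; rewrite tu => /addnI ab.
    suff -> : a = b by [].
    apply/val_inj/(inj_map val_inj)/yi => //; rewrite ?size_map ?size_tuple //.
    - by apply/allP => _ /mapP[i _ ->] /=; case: i.
    - by apply/allP => _ /mapP[i _ ->] /=; case: i.
  move=> _ /allpairsPdep[a [t [_ + ->]]]; rewrite mem_filter => /andP[h tT].
  by apply: allpairs_f.
have : \sum_(a : (size y).-tuple 'I_q) size T <= 2 * (size T * size T).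
  apply: leq_trans (leq_mul (leqnn 2) tot); rewrite big_distrr /=.
  by apply: leq_sum.
rewrite sum_nat_const card_tuple card_ord mulnA leq_pmul2r //.
by rewrite leqNgt Tq.
Qed.

(** * Maximal independent lists and the relations they force *)

Lemma exists_independent_or_maximal (q R : nat) (P : seq nat) :
  (exists y, [/\ size y = R, {subset y <= P} & independent q y]) \/
  (exists y, [/\ size y < R, {subset y <= P}, independent q y &
                 {in P, forall x, ~ independent q (x :: y)}]).
Proof.
elim: R => [|R [[y [yR yP yi]]|[y [yR yP yi ymax]]]].
- by left; exists [::]; split=> // [[|? ?] []].
- have [[x [xP xi]]|nox] :=
      pselect (exists x, x \in P /\ independent q (x :: y)).
    left; exists (x :: y); split=> //=; first by rewrite yR.
    by move=> z; rewrite inE => /orP[/eqP->//|/yP].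
  right; exists y; split=> //; first by rewrite yR.
  by move=> x xP xi; apply: nox; exists x.
- by right; exists y; split=> //; exact: ltnW.
Qed.

Lemma dot_cat_nseq0 (a y : seq nat) (i j : nat) : size a = size y ->
  dot (a ++ nseq i 0) (y ++ nseq j 0) = dot a y.
Proof.
elim: a y => [|a0 a IH] [|y0 y] //=; last by case=> ay; rewrite IH.
by move=> _; elim: i j => [|i IH] [|j] //=; rewrite IH.
Qed.

(* The solution [x] of [e * x + dot a y = dot b y], for [w = (a, b, e)]. *)
Definition dot_quotient (q r : nat) (y : seq nat)
    (w : r.-tuple 'I_q * r.-tuple 'I_q * 'I_q) : nat :=
  (dot (map val w.1.2) y - dot (map val w.1.1) y) %/ w.2.
Arguments dot_quotient {q r} y w.

(** Dependence gives two coefficient vectors with equal sums. Their leading coefficients differ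
    because [y] is independent, so the relation can be solved for [x]. Padding [y] with zeros to
    length [r] makes the type of [w] the same for all lengths of [y]. *)
Lemma dependent_dot_quotient (q r j x : nat) (y : seq nat) :
  size y + j = r -> independent q y -> ~ independent q (x :: y) ->
  exists w : r.-tuple 'I_q * r.-tuple 'I_q * 'I_q,
    x = dot_quotient (y ++ nseq j 0) w.
Proof.
move=> yr yi; apply: contra_notP => noquo.
(* If [b0 < a0], then [x] is a quotient. Used both ways, this makes the leading coefficients equal,
   and [yi] settles the rest. *)
suff lt a0 b0 a b : size a = size y -> size b = size y ->
    all (ltn^~ q) (a0 :: a) -> all (ltn^~ q) (b0 :: b) ->
    dot (a0 :: a) (x :: y) = dot (b0 :: b) (x :: y) -> a0 <= b0.
  move=> [|a0 a] [|b0 b] //= [ay] [bY] aq bq ab.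
  have := lt a0 b0 a b ay bY aq bq ab.
  have := lt b0 a0 b a bY ay bq aq (esym ab).
  move=> h1 h2; have e : a0 = b0 by lia.
  move: ab aq bq; rewrite e => /addnI ab /andP[_ aq] /andP[_ bq].
  by rewrite (yi a b).
move=> ay bY aq bq /= ab; rewrite leqNgt; apply/negP => b0a0; apply: noquo.
(* [inord] needs a bound that is visibly a successor. *)
have [q0 qE] : exists q0, q = q0.+1.
  by case: q aq {yi bq} => [|q0] //= _; exists q0.
subst q.
pose tup (c : seq nat) : r.-tuple 'I_q0.+1 :=
  [tuple of mkseq (fun i => inord (nth 0 c i)) r].
have tupE c : size c = size y -> all (ltn^~ q0.+1) c ->
    map val (tup c) = c ++ nseq j 0.
  move=> cy cq; apply: (@eq_from_nth _ 0).
    by rewrite size_map size_tuple size_cat size_nseq cy.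
  move=> i; rewrite size_map size_tuple => ir.
  rewrite (nth_map ord0) ?size_tuple // nth_mkseq // nth_cat nth_nseq /=.
  rewrite inordK.
    case: (ltnP i (size c)) => // ic; rewrite nth_default //; by case: ifP.
  case: (ltnP i (size c)) => ic; last by rewrite nth_default.
  by move/allP: cq; apply; exact: mem_nth.
move: (aq) (bq) => /= /andP[a0q aq'] /andP[b0q bq'].
exists (tup a, tup b, inord (a0 - b0)).
rewrite /dot_quotient /= !tupE // !dot_cat_nseq0 // inordK; last by lia.
have -> : dot b y - dot a y = x * (a0 - b0) by rewrite mulnBr; lia.
by rewrite mulnK //; lia.
Qed.

(** * Many subset sums, or linear structure *)

Lemma subset_sums_growth (q R k : nat) (X : seq nat) : uniq X ->
  size X = k + k ->
  (forall P, uniq P -> {subset P <= X} -> k <= size P ->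
    exists y, [/\ size y = R, {subset y <= P} & independent q y]) ->
  forall j, j <= k -> exists l,
    [/\ uniq l, size l = j, {subset l <= X} &
      q ^ R <= 2 * size (subset_sums l) \/
      (2 * (R * q)).+1 ^ j <= (2 * (R * q)) ^ j * size (subset_sums l)].
Proof.
move=> uX sX indep; elim=> [|j IH] jk.
  by exists [::]; split=> //; right; rewrite !expn0.
have [l [ul sl lX lbig]] := IH (ltnW jk).
pose P := [seq x <- X | x \notin l].
have uP : uniq P by rewrite filter_uniq.
have PX : {subset P <= X} by exact: mem_subseq (filter_subseq _ _).
have kP : k <= size P.
  rewrite /P size_filter -[count _ X]/(count (predC (mem l)) X).
  have := count_predC (mem l) X; rewrite sX.
  suff : count (mem l) X <= size l by rewrite sl; lia.
  rewrite -size_filter.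
  apply: uniq_leq_size; first by rewrite filter_uniq.
  by move=> x; rewrite mem_filter => /andP[].
have ext x : x \in P -> [/\ uniq (x :: l), size (x :: l) = j.+1
    & {subset x :: l <= X}].
  move=> xP; move: (xP); rewrite mem_filter => /andP[xl xX].
  split=> /=; rewrite ?xl ?ul ?sl //.
  by move=> z; rewrite inE => /orP[/eqP->//|/lX].
have [big|small] := leqP (q ^ R) (2 * size (subset_sums l)).
  have [x xP] : exists x, x \in P.
    case: P kP {uP PX ext} => [|x P] kP; first by move: jk kP => /=; lia.
    by exists x; rewrite mem_head.
  have [u s sub] := ext x xP; exists (x :: l); split=> //; left.
  by rewrite size_subset_sums_cons mulnDr (leq_trans big) // leq_addr.
have [y [yR yP yi]] := indep P uP PX kP.
have T0 : 0 < size (subset_sums l).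
  by case: (subset_sums l) (subset_sums0 l).
have [x xy] := independent_escape q y _ (subset_sums_uniq l) T0 yi
  (eq_ind_r (fun r => _ < q ^ r) small yR).
rewrite yR => esc.
have [u s sub] := ext x (yP x xy); exists (x :: l); split=> //; right.
case: lbig => [big|lbig]; first by move: small; rewrite ltnNge big.
rewrite size_subset_sums_cons !expnS.
move: lbig esc; set m := 2 * (R * q); set T := size _; set e := escape _ _.
set A := m.+1 ^ j; set B := m ^ j => lbig esc.
apply: leq_trans (leq_mul (leqnn m.+1) lbig) _.
rewrite mulnCA -[m * B * _]mulnAC [_ * B]mulnC leq_mul2l; apply/orP; right.
by lia.
Qed.

Lemma seq_map_preimage (S T : eqType) (f : T -> S) (l : seq S) :
  {in l, forall x, exists w, x = f w} -> exists ws, l = map f ws.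
Proof.
elim: l => [|x l IH] lf; first by exists [::].
have [w ->] := lf x (mem_head _ _).
have [z zl|ws ->] := IH; first by apply: lf; rewrite inE zl orbT.
by exists (w :: ws).
Qed.

(** If growth fails, some [P] has a maximal independent list of at most [r] elements, over which
    every element of [P] is a quotient. Its padding by zeros is why [y] lies in [0 :: X]. *)
Lemma cube_dichotomy (q r k : nat) (X : seq nat) : uniq X ->
  size X = k + k -> 0 \notin X ->
  (exists l, [/\ size l = k, {subset l <= X}, uniq l &
    q ^ r.+1 <= 2 * size (subset_sums l) \/
      (2 * (r.+1 * q)).+1 ^ k <= (2 * (r.+1 * q)) ^ k * size (subset_sums l)])
  \/ (exists (l : seq nat) (y : r.-tuple nat)
       (w : k.-tuple (r.-tuple 'I_q * r.-tuple 'I_q * 'I_q)),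
      [/\ l = map (dot_quotient y) w, {subset l <= X}, uniq l,
          {subset y <= 0 :: X} & k ^ 2 <= 2 * size (subset_sums l)]).
Proof.
move=> uX sX X0.
have [indep|nind] := pselect (forall P, uniq P -> {subset P <= X} ->
    k <= size P ->
    exists y, [/\ size y = r.+1, {subset y <= P} & independent q y]).
  left; have [l [ul sl lX lbig]] :=
    subset_sums_growth q r.+1 k X uX sX indep k (leqnn k).
  by exists l.
right; have [P [uP PX kP noy]] : exists P, [/\ uniq P, {subset P <= X},
    k <= size P & ~ exists y, [/\ size y = r.+1, {subset y <= P} &
      independent q y]].
  apply: contrapT => noP; apply: nind => P uP PX kP.
  by apply: contrapT => noy; apply: noP; exists P.
have [//|[y [yr yP yi ymax]]] := exists_independent_or_maximal q r.+1 P.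
(* Any [k] elements of [P] satisfy relations; the descending order serves the quadratic bound on the
   number of sums. *)
pose l := take k (sort geq P).
have lP : {subset l <= P} by move=> x /mem_take; rewrite mem_sort.
have [x xl|w lw] := seq_map_preimage _ _
    (@dot_quotient q r (y ++ nseq (r - size y) 0)) l.
  by apply: dependent_dot_quotient yi (ymax x (lP x xl)); rewrite subnKC.
have sl : size l = k by rewrite size_take_min size_sort (minn_idPl kP).
have yrP : size (y ++ nseq (r - size y) 0) == r.
  by rewrite size_cat size_nseq subnKC.
have wk : size w == k by rewrite -sl lw size_map.
exists l, (Tuple yrP), (Tuple wk); split=> //.
- by move=> x /lP/PX.
- by rewrite take_uniq // sort_uniq.
- move=> x; rewrite mem_cat => /orP[/yP/PX xX|]; first by rewrite inE xX orbT.
  by rewrite mem_nseq inE => /andP[_ ->].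
- rewrite -{1}sl; apply: size_subset_sums_sorted.
    apply: take_sorted; rewrite gtn_sorted_uniq_geq sort_uniq uP /=.
    by apply: sort_sorted => a b; exact: leq_total.
  by apply/negP => /lP/PX; apply/negP.
Qed.

(** Since (1 + 1/m)^m >= 2, each block of [m] steps doubles the count. *)
Lemma leq_pow2_growth (m j : nat) (T : nat) :
  0 < m -> m.+1 ^ (m * j) <= m ^ (m * j) * T -> 2 ^ j <= T.
Proof.
move=> m0 h; suff e : 2 * m ^ m <= m.+1 ^ m.
  have : (2 * m ^ m) ^ j <= m ^ (m * j) * T.
    apply: leq_trans h; rewrite expnM.
    by case: (j) => [|i]; rewrite ?expn0 // leq_exp2r.
  by rewrite expnMn -expnM mulnC leq_pmul2l // expn_gt0 m0.
(* Bernoulli's inequality 1 + i/m <= (1 + 1/m)^i, used at [i = m]. *)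
have bern i : (m + i) * m ^ i <= m * m.+1 ^ i.
  elim: i => [|i IH]; first by rewrite addn0.
  rewrite !expnS mulnCA [leqRHS]mulnCA.
  apply: leq_trans (leq_mul (leqnn m.+1) IH).
  by rewrite mulnA mulnCA !mulnA leq_mul2r; apply/orP; right; nia.
by have := bern m; rewrite addnn -mul2n -mulnA mulnCA leq_pmul2l.
Qed.

(** * Cubes inside a subset of [n] as lists of generators *)

(** Recording that the indices in [I] come from [l] shows in the induction that the next index is
    new, because [l] has no repetition. *)
Lemma subset_sums_cube (d : nat) (x : 'I_d -> nat) (l : seq nat) (z : nat) :
  uniq l -> {subset l <= codom x} -> z \in subset_sums l ->
  exists2 I : {set 'I_d}, z = \sum_(i in I) x i & {in I, forall i, x i \in l}.
Proof.
elim: l z => [|a l IH] z.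
  rewrite inE => _ _ /eqP->; exists finset.set0; rewrite ?big_set0 // => i.
  by rewrite inE.
move=> /= /andP[al ul] sub.
have {}IH t := IH t ul (fun b bl => sub b (mem_behead (s := a :: l) bl)).
case/mem_subset_sums_cons => [/IH[I -> Il]|[t /IH[I -> Il] ->]].
  by exists I => // i /Il il; rewrite inE il orbT.
have /codomP[i0 ai0] := sub a (mem_head _ _).
exists (i0 |: I)%SET.
  rewrite big_setU1 /=; first by rewrite -ai0 addnC.
  by apply/negP => /Il; rewrite -ai0 (negPf al).
move=> i; rewrite !inE => /orP[/eqP->|/Il->]; last by rewrite orbT.
by rewrite -ai0 eqxx.
Qed.

(** The index [i] stands for [i + 1], as in [to_nat_set]; sums outside [1, n] are dropped. *)
Definition translate_in (n x0 : nat) (l : seq nat) : {set 'I_n} :=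
  [set i : 'I_n | i.+1 \in map (addn x0) (subset_sums l)]%SET.

Lemma card_translate_in (n x0 : nat) (l : seq nat) :
  {in subset_sums l, forall z, 0 < x0 + z <= n} ->
  size (subset_sums l) <= #|translate_in n x0 l|.
Proof.
move=> h; rewrite -(size_map (addn x0)) cardE.
rewrite -(size_map (fun i : 'I_n => i.+1)).
apply: uniq_leq_size.
  by rewrite map_inj_uniq ?subset_sums_uniq //; exact: addnI.
move=> _ /mapP[z zl ->]; have /andP[z0 zn] := h z zl.
have zp : (x0 + z).-1 < n by lia.
apply/mapP; exists (Ordinal zp) => /=; last by lia.
by rewrite mem_enum inE /= prednK // map_f.
Qed.

(** Keep [k + k] of the generators. The cube elements of the empty index set and of the singletons
    bound [x0] and the generators by [n], which leaves finitely many choices for a union bound. *)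
Lemma contains_cube_list (R : realType) (t : R) (n k : nat) (A : {set 'I_n}) :
  ((k + k)%:R <= t)%R -> contains_cube_of_dim_ge t (to_nat_set A) ->
  exists (x0 : nat) (X : seq nat), [/\ uniq X, size X = k + k, 0 \notin X &
    forall l, uniq l -> {subset l <= X} ->
      [/\ x0 <= n, {in l, forall x, x <= n},
          size (subset_sums l) <= #|translate_in n x0 l| &
          translate_in n x0 l \subset A]].
Proof.
move=> kt [d [H [td [x0 [x [xpos xinj ->]]] HA]]].
have kd : k + k <= d by rewrite -(ler_nat R) (le_trans kt).
have cube (I : {set 'I_d}) :
    exists2 i : 'I_n, i \in A & i.+1 = x0 + \sum_(i in I) x i.
  have [i iA <-] : to_nat_set A (x0 + \sum_(i in I) x i) by apply: HA; exists I.
  by exists i.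
exists x0, (take (k + k) (codom x)); split.
- by rewrite take_uniq // codomE map_inj_uniq // enum_uniq.
- by rewrite size_takel // size_codom card_ord.
- by apply/negP => /mem_take/codomP[i e]; have := xpos i; rewrite -e.
move=> l ul lX.
have lx : {subset l <= codom x} by move=> z /lX/mem_take.
have sums z : z \in subset_sums l -> exists2 i : 'I_n, i \in A & i.+1 = x0 + z.
  by move=> /(subset_sums_cube d x l z ul lx)[I -> _].
split.
- have [i _] := cube finset.set0; rewrite big_set0 addn0 => <-; exact: ltn_ord.
- move=> z /lx/codomP[j ->]; have [i _] := cube [set j]%SET; rewrite big_set1.
  by have := ltn_ord i; lia.
- apply: card_translate_in => z /sums[i _ <-] /=; exact: ltn_ord.
- apply/fintype.subsetP => i; rewrite inE => /mapP[z /sums[j jA <-] [ij]].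
  by rewrite (val_inj ij).
Qed.

(** * The union bound over encoded cubes *)

Lemma sum_random_subset_weight_superset (R : realType) (delta : R) (n : nat)
    (B : {set 'I_n}) :
  (\sum_(A : {set 'I_n} | B \subset A) random_subset_weight delta A =
   delta ^+ #|B|)%R.
Proof.
(* Expanding this product gives one term for each [A], which vanishes unless [A] contains [B]. *)
transitivity (\prod_(i < n) (delta + (if i \in B then 0 else 1 - delta)))%R.
  rewrite bigA_distr big_mkcond /=; apply: eq_bigr => A _.
  case: ifPn => [BA|/fintype.subsetPn[i iB iA]].
    apply: eq_bigr => i _; case: ifPn => // iA; case: ifPn => // iB.
    by rewrite (fintype.subsetP BA) in iA.
  by rewrite (bigD1 i) //= (negPf iA) iB mul0r.
rewrite -prodr_const [RHS]big_mkcond /=; apply: eq_bigr => i _.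
by case: ifP => _; rewrite ?addr0 // addrC subrK.
Qed.

Lemma random_subset_weight_ge0 (R : realType) (delta : R) (n : nat)
    (A : {set 'I_n}) :
  (0 <= delta <= 1)%R -> (0 <= random_subset_weight delta A)%R.
Proof.
by case/andP=> d0 d1; apply: prodr_ge0 => i _; case: ifP; rewrite ?subr_ge0.
Qed.

Lemma random_subset_union_bound (R : realType) (delta : R) (n m1 m2 : nat)
    (E : set nat -> Prop) (W1 W2 : finType)
    (f1 : W1 -> {set 'I_n}) (f2 : W2 -> {set 'I_n}) :
  (0 <= delta <= 1)%R ->
  (forall A : {set 'I_n}, E (to_nat_set A) ->
    (exists2 w, m1 <= #|f1 w| & f1 w \subset A) \/
    (exists2 w, m2 <= #|f2 w| & f2 w \subset A)) ->
  (random_subset_prob delta n E <=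
    #|W1|%:R * delta ^+ m1 + #|W2|%:R * delta ^+ m2)%R.
Proof.
move=> d01 cover.
have w0 A := random_subset_weight_ge0 R delta n A d01.
have bound (W : finType) (f : W -> {set 'I_n}) (m : nat) :
    (\sum_(A : {set 'I_n} | [exists w, (m <= #|f w|)%N && (f w \subset A)])
      random_subset_weight delta A <= #|W|%:R * delta ^+ m)%R.
  (* Codes of sets with fewer than [m] elements are left out; for the others [delta <= 1] lowers the
     exponent to [m]. *)
  apply: (@le_trans _ _ (\sum_(w : W | (m <= #|f w|)%N)
      \sum_(A : {set 'I_n} | f w \subset A) random_subset_weight delta A)%R).
    rewrite (exchange_big_dep xpredT) //= big_mkcond /=.
    apply: ler_sum => A _; case: ifP => [/existsP[w /andP[mw wA]]|_].
      rewrite (bigD1 w) /=; last by rewrite mw.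
      by rewrite lerDl sumr_ge0.
    by rewrite sumr_ge0.
  rewrite mulr_natl -sumr_const big_mkcond /=; apply: ler_sum => w _.
  case/andP: d01 => d0 d1.
  case: ifP => mw; last by rewrite exprn_ge0.
  by rewrite sum_random_subset_weight_superset ler_wiXn2l.
apply: le_trans (lerD (bound _ f1 m1) (bound _ f2 m2)).
rewrite /random_subset_prob !(big_mkcond (fun A => [exists w, _])) /=.
rewrite big_mkcond -big_split /=; apply: ler_sum => A _.
case: asboolP => [/cover|_]; last by rewrite addr_ge0 //; case: ifP.
case=> [][w mw wA].
  have -> : [exists w, (m1 <= #|f1 w|) && (f1 w \subset A)].
    by apply/existsP; exists w; rewrite mw.
  by rewrite lerDl; case: ifP.
have -> : [exists w, (m2 <= #|f2 w|) && (f2 w \subset A)].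
  by apply/existsP; exists w; rewrite mw.
by rewrite lerDr; case: ifP.
Qed.

Lemma cube_prob_le (R : realType) (delta t : R) (n k q r m : nat) :
  (0 <= delta <= 1)%R -> ((k + k)%:R <= t)%R ->
  (forall T, q ^ r.+1 <= 2 * T \/
     (2 * (r.+1 * q)).+1 ^ k <= (2 * (r.+1 * q)) ^ k * T -> m <= T) ->
  (random_subset_prob delta n (contains_cube_of_dim_ge t) <=
    (n.+1 * n.+1 ^ k)%:R * delta ^+ m +
    (n.+1 * (n.+1 ^ r * (q ^ r * q ^ r * q) ^ k))%:R * delta ^+ (k ^ 2 %/ 2))%R.
Proof.
move=> d01 kt big.
(* [W1] encodes [x0] and [k] generators; [W2] encodes [x0], a padded independent list and the
   coefficients of [k] relations over it. *)
pose W1 := ('I_n.+1 * k.-tuple 'I_n.+1)%type.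
pose W2 := ('I_n.+1 * (r.-tuple 'I_n.+1 *
  k.-tuple (r.-tuple 'I_q * r.-tuple 'I_q * 'I_q)))%type.
pose f1 (w : W1) := translate_in n w.1 (map val w.2).
pose f2 (w : W2) :=
  translate_in n w.1 (map (dot_quotient (map val w.2.1)) w.2.2).
have -> : n.+1 * n.+1 ^ k = #|{: W1}|.
  by rewrite card_prod card_tuple !card_ord.
have -> : n.+1 * (n.+1 ^ r * (q ^ r * q ^ r * q) ^ k) = #|{: W2}|.
  by rewrite !card_prod !card_tuple !card_prod !card_tuple !card_ord.
apply: (random_subset_union_bound _ _ _ _ _ _ _ _ f1 f2) => //.
move=> A /(contains_cube_list _ _ _ _ _ kt)[x0 [X [uX sX X0 sub]]].
have ordtup (j : nat) (l : seq nat) : size l = j -> {in l, forall x, x <= n} ->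
    exists w : j.-tuple 'I_n.+1, map val w = l.
  move=> lj ln; have [x xl|w lw] := seq_map_preimage _ _ (@nat_of_ord n.+1) l.
    by exists (inord x); rewrite inordK // ltnS ln.
  have wj : size w == j by rewrite -lj lw size_map.
  by exists (Tuple wj).
have [[l [sl lX ul lbig]]|[l [y [w [lw lX ul yX lbig]]]]] :=
    cube_dichotomy q r k X uX sX X0.
- left; have [x0n ln lsize lA] := sub l ul lX.
  have [w wl] := ordtup k l sl ln.
  exists (inord x0, w); rewrite /f1 /f2 /= inordK // wl //.
  by apply: leq_trans lsize; exact: big.
- right; have [x0n ln lsize lA] := sub l ul lX.
  have [_ Xn _ _] := sub X uX (fun _ => id).
  have [|y' y'y] := ordtup r y (size_tuple y).
    by move=> x /yX; rewrite inE => /orP[/eqP->//|/Xn].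
  exists (inord x0, (y', w)); rewrite /f1 /f2 /= inordK // y'y -lw //.
  by apply: leq_trans lsize; lia.
Qed.

(** As k = 16 q q, growth by 1 + 1/(16 q) in each of [k] steps yields 2^q = (2^v)^8 >= v^8 sums; the
    alternative q^8 / 2 is also at least v^8. The exponent 10 q^4 weakens k^2 / 2 = 128 q^4: it need
    only beat the 8 in (n + 1)^8. *)
Lemma cube_prob_le_pow8 (R : realType) (delta t : R) (n v : nat) :
  let q := 8 * v in let k := 16 * q ^ 2 in
  0 < v -> (0 <= delta <= 1)%R -> ((k + k)%:R <= t)%R ->
  (random_subset_prob delta n (contains_cube_of_dim_ge t) <=
    (n.+1 ^ k.+1)%:R * delta ^+ (v ^ 8) +
    (n.+1 ^ 8 * q ^ (15 * k))%:R * delta ^+ (10 * q ^ 4))%R.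
Proof.
move=> q k v0 d01 kt; have [d0 d1] := andP d01.
apply: le_trans (cube_prob_le _ _ _ n k q 7 (v ^ 8) d01 kt _) _.
  move=> T; have kE : k = 2 * (8 * q) * q by rewrite /k; lia.
  case=> [h|]; last first.
    rewrite kE => /leq_pow2_growth h; apply: leq_trans (h _); last by lia.
    rewrite /q mulnC expnM leq_exp2r //; exact/ltnW/ltn_expl.
  rewrite -(@leq_pmul2l 2) //; apply: leq_trans h.
  rewrite ![_ ^ 8]expnS mulnA; apply: leq_mul; first by lia.
  by rewrite leq_exp2r // /q; lia.
have -> : n.+1 * (n.+1 ^ 7 * (q ^ 7 * q ^ 7 * q) ^ k) =
    n.+1 ^ 8 * q ^ (15 * k).
  by rewrite mulnA -expnS -expnD -expnSr -expnM.
rewrite -expnS lerD2l //.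
apply: ler_wpM2l => //; apply: ler_wiXn2l => //.
by rewrite leq_divRL // /k expnMn -expnM; lia.
Qed.

Local Open Scope ring_scope.

(** * Estimates of the two exponents *)

(** This bounds the logarithm of the first term, with k = 1024 v^2, delta = exp(-lam) and ln(n + 1)
    <= lam v^4. The negative term wins because 33^2 = 1089 exceeds 1024 + 1. *)
Lemma large_cube_exponent (R : realType) (lam v : R) :
  33 <= v -> 1 <= lam * v ->
  (1024 * v ^+ 2 + 1) * (lam * v ^+ 4) - lam * v ^+ 8 <= - v.
Proof.
move=> v33 lv1; set w := lam * v ^+ 6.
have lv4 : lam * v ^+ 4 <= w.
  have -> : lam * v ^+ 4 = lam * v * v ^+ 3 by ring.
  have -> : w = lam * v * v ^+ 3 * v ^+ 2 by rewrite /w; ring.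
  rewrite ler_peMr //; last by nra.
  by rewrite mulr_ge0 ?exprn_ge0 //; lra.
have vw : v <= w.
  have -> : w = lam * v * v ^+ 4 * v by rewrite /w; ring.
  have h4 : 1 <= v ^+ 4 by rewrite exprn_ege1 //; lra.
  by rewrite ler_peMl //; [lra | nra].
have -> : lam * v ^+ 8 = w * v ^+ 2 by rewrite /w; ring.
have -> : (1024 * v ^+ 2 + 1) * (lam * v ^+ 4) = 1024 * w + lam * v ^+ 4.
  by rewrite /w; ring.
have : 1089 <= v ^+ 2 by nra.
have : 0 <= w by lra.
nra.
Qed.

(** The same for the second term, with k = 16 q^2 and the coefficient count q^(15 k) estimated
    through q <= exp(q). The bound 121 makes 240 - 2 lam q at most -2. *)
Lemma structured_cube_exponent (R : realType) (lam q : R) :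
  1 <= q -> 121 <= lam * q ->
  8 * (lam * q ^+ 4) + 15 * (16 * q ^+ 2) * q - lam * (10 * q ^+ 4) <= - q.
Proof.
move=> q1 lq.
have q3 : q <= q ^+ 3 by rewrite exprS ler_peMr ?exprn_ege1 //; lra.
have -> : 8 * (lam * q ^+ 4) + 15 * (16 * q ^+ 2) * q - lam * (10 * q ^+ 4) =
  (240 - 2 * (lam * q)) * q ^+ 3 by ring.
nra.
Qed.

Lemma cube_prob_le_expR (R : realType) (lam t : R) (n v : nat) :
  (33 <= v)%N -> 121 <= lam * v%:R ->
  2048 * v%:R ^+ 2 <= t -> ln (n.+1%:R : R) <= lam * v%:R ^+ 4 ->
  random_subset_prob (expR (- lam)) n (contains_cube_of_dim_ge t) <=
    2 * expR (- v%:R).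
Proof.
move=> v33 lv vt ln_n.
have v33R : 33 <= v%:R :> R by rewrite ler_nat.
have lam0 : 0 < lam by rewrite -(pmulr_lgt0 _ (_ : 0 < v%:R)); lra.
pose q := (8 * v)%N; pose k := (16 * q ^ 2)%N.
have kE : k%:R = 16 * q%:R ^+ 2 :> R by rewrite /k natrM natrX.
have qE : q%:R = 8 * v%:R :> R by rewrite /q natrM.
have d01 : 0 <= expR (- lam) <= 1.
  by rewrite expR_ge0 -expR0 ler_expR oppr_le0 ltW.
have v0 : (0 < v)%N by exact: leq_trans v33.
have kt : (k + k)%:R <= t.
  by rewrite natrD kE qE (le_trans _ vt) //; lra.
have h := cube_prob_le_pow8 R (expR (- lam)) t n v v0 d01 kt.
apply: le_trans h _; rewrite -/q -/k.
have n1E : n.+1%:R = expR (ln n.+1%:R) :> R by rewrite lnK // posrE.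
have l0 : 0 <= ln (n.+1%:R : R) by rewrite ln_ge0 // ler1n.
have -> : 2 * expR (- v%:R) = expR (- v%:R) + expR (- v%:R) :> R by ring.
rewrite natrM !natrX n1E -!expRM_natl.
apply: lerD.
  rewrite -expRD ler_expR natrX.
  have := large_cube_exponent R lam v%:R v33R; rewrite -(natr1 k) kE qE => h.
  have : (16 * (8 * v%:R) ^+ 2 + 1) * ln (n.+1%:R : R) <=
         (1024 * v%:R ^+ 2 + 1) * (lam * v%:R ^+ 4).
    have -> : 16 * (8 * v%:R) ^+ 2 = 1024 * v%:R ^+ 2 :> R by ring.
    have v2 : 0 <= v%:R ^+ 2 :> R by rewrite exprn_ge0.
    by apply: ler_wpM2l; [lra | exact: ln_n].
  have lv1 : 1 <= lam * v%:R by lra.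
  by have := h lv1; lra.
have qexp : q%:R <= expR q%:R :> R.
  by have := expR_ge1Dx (q%:R : R); lra.
apply: (@le_trans _ _ (expR (8 * ln n.+1%:R) * expR ((15 * k)%:R * q%:R) *
    expR ((10 * q ^ 4)%:R * - lam))).
  rewrite ler_wpM2r ?expR_ge0 // ler_wpM2l ?expR_ge0 // expRM_natl.
  by apply: lerXn2r => //; rewrite nnegrE // expR_ge0.
rewrite -!expRD ler_expR (natrM _ 15) (natrM _ 10) natrX kE.
have vq : v%:R <= q%:R :> R by rewrite qE; lra.
have v4q : lam * v%:R ^+ 4 <= lam * q%:R ^+ 4.
  by rewrite ler_pM2l // lerXn2r ?nnegrE.
have q1 : 1 <= q%:R :> R by lra.
have lq : 121 <= lam * q%:R.
  by apply: le_trans lv _; rewrite ler_pM2l.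
have := structured_cube_exponent R lam q%:R q1 lq; lra.
Qed.

(** * Choice of the constants and passage to the limit *)

Lemma random_subset_prob_ge0 (R : realType) (delta : R) (n : nat)
    (E : set nat -> Prop) :
  0 <= delta <= 1 -> 0 <= random_subset_prob delta n E.
Proof.
by move=> d01; apply: sumr_ge0 => A _; exact: random_subset_weight_ge0.
Qed.

Lemma lnS_le (R : realType) (n : nat) : (2 <= n)%N ->
  ln (n.+1%:R : R) <= 2 * ln n%:R.
Proof.
move=> n2; have n0 : (0 < n)%N by lia.
have -> : 2 * ln n%:R = ln (n%:R ^+ 2 : R).
  by rewrite lnXn ?ltr0n // mulr_natl.
by rewrite -natrX ler_ln ?posrE ?ltr0n ?expn_gt0 ?n0 // ler_nat -mulnn; nia.
Qed.

Lemma ln2_le1 (R : realType) : ln (2 : R) <= 1.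
Proof. by have := @le_ln1Dx R 1 ltac:(lra). Qed.

(** The fourth power of the last hypothesis gives c^2 log2 x = t^2 <= b^8 v^4 = c^2 lam v^4 / 2. The
    factor 2 before [ln x] pays for ln(n + 1) <= 2 ln n. *)
Lemma ln_le_of_cube_dim (R : realType) (b c lam x : R) (v : nat) :
  let t := c * Num.sqrt (log2 x) in
  0 < b -> 0 < c -> 0 < lam -> c ^+ 2 * lam = 2 * b ^+ 8 -> 1 <= x ->
  Num.sqrt t <= b ^+ 2 * v%:R ->
  2 * ln x <= lam * v%:R ^+ 4.
Proof.
move=> t b0 c0 lam0 clam x1 tv.
have lx : 0 <= ln x by rewrite ln_ge0.
have l2 : 0 < ln (2 : R) by rewrite ln_gt0 //; lra.
have lg0 : 0 <= log2 x by rewrite divr_ge0 // ltW.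
have lxlg : ln x <= log2 x.
  by rewrite ler_pdivlMr // ler_piMr // ln2_le1.
have t0 : 0 <= t by rewrite mulr_ge0 ?sqrtr_ge0 // ltW.
have t2 : t ^+ 2 = c ^+ 2 * log2 x by rewrite exprMn sqr_sqrtr.
have tE : t ^+ 2 <= b ^+ 8 * v%:R ^+ 4.
  have -> : b ^+ 8 * v%:R ^+ 4 = (b ^+ 2 * v%:R) ^+ 4 by ring.
  have -> : t ^+ 2 = Num.sqrt t ^+ 4 by rewrite -[in LHS](sqr_sqrtr t0) -exprM.
  apply: lerXn2r tv; first by rewrite nnegrE sqrtr_ge0.
  by rewrite nnegrE mulr_ge0 ?exprn_ge0 // ltW.
have c2 : 0 < c ^+ 2 by rewrite exprn_gt0.
rewrite -(ler_pM2l c2).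
have -> : c ^+ 2 * (lam * v%:R ^+ 4) = 2 * (b ^+ 8 * v%:R ^+ 4).
  by rewrite mulrA clam mulrA.
have : c ^+ 2 * ln x <= c ^+ 2 * log2 x by rewrite ler_pM2l.
by rewrite -t2 mulrCA ler_pM2l //; lra.
Qed.

Local Open Scope classical_set_scope.
Local Open Scope ring_scope.

Theorem theorem7p1 (R : realType) (delta : R) (delta_gt0 : 0 < delta)
    (delta_lt1 : delta < 1) :
  exists2 c : R, 0 < c &
    random_subset_prob delta n
      (contains_cube_of_dim_ge (c * Num.sqrt (log2 (n%:R : R)))) @[n --> \oo]
      --> (0 : R).
Proof.
pose lam := - ln delta.
have lam0 : 0 < lam by rewrite oppr_gt0 ln_lt0 // delta_gt0.
have dE : delta = expR (- lam) by rewrite opprK lnK // posrE.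
have d01 : 0 <= delta <= 1 by rewrite !ltW.
(* Below, [v] is the integer part of s / 72, where 72 = b^2 / 2. Then s < 72 (v + 1) <= b^2 v, while
   t = s^2 >= (72 v)^2 >= 2048 v^2. *)
pose b : R := 12.
have b0 : 0 < b by rewrite /b; lra.
pose c := Num.sqrt (2 * b ^+ 8 / lam).
have cpos : 0 < 2 * b ^+ 8 / lam.
  by rewrite divr_gt0 // mulr_gt0 ?exprn_gt0 //; lra.
have c0 : 0 < c by rewrite sqrtr_gt0.
have clam : c ^+ 2 * lam = 2 * b ^+ 8.
  by rewrite sqr_sqrtr ?ltW // divfK // gt_eqF.
exists c => //; apply/cvgr0Pnorm_lt => e e0.
(* [V] collects the lower bounds required of [v]. [Y] solves c sqrt(Y) = (72 V)^2, so that ln n >= Y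
   forces v >= V. *)
pose V := maxn 33 (maxn (Num.truncn (121 / lam)).+1 (Num.truncn (2 / e)).+1).
pose Y := ((72 * V%:R) ^+ 2 / c) ^+ 2.
exists (maxn 2 (Num.truncn (expR Y)).+1) => // n /=.
rewrite geq_max => /andP[n2 nY].
set t := c * _; pose s := Num.sqrt t.
have Yn : Y <= ln n%:R.
  have n0 : 0 < n%:R :> R by rewrite ltr0n ltnW.
  rewrite -(expRK Y) ler_ln ?posrE ?expR_gt0 //.
  by apply: ltW; rewrite -truncn_lt_nat ?expR_ge0.
have l2 : 0 < ln (2 : R) by rewrite ln_gt0 //; lra.
have Ylg : Y <= log2 n%:R.
  rewrite ler_pdivlMr //; apply: (le_trans _ Yn).
  by rewrite ler_piMr ?ln2_le1 // sqr_ge0.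
have sV : 72 * V%:R <= s.
  have V0 : 0 <= 72 * V%:R :> R by rewrite mulr_ge0.
  rewrite -(ger0_norm V0) -sqrtr_sqr ler_sqrt; last first.
    by rewrite mulr_ge0 ?sqrtr_ge0 // ltW.
  rewrite /t [c * _]mulrC -ler_pdivrMr //.
  have Z0 : 0 <= (72 * V%:R) ^+ 2 / c by rewrite divr_ge0 ?sqr_ge0 ?ltW.
  rewrite -(ger0_norm Z0) -sqrtr_sqr ler_sqrt //.
  by apply: le_trans Ylg; exact: sqr_ge0.
pose v := Num.truncn (s / 72).
have s0 : 0 <= s / 72 by rewrite divr_ge0 ?sqrtr_ge0.
have /andP[vs sv] := truncn_itv s0; rewrite -/v in vs sv.
have Vv : (V <= v)%N by rewrite truncn_ge_nat // ler_pdivlMr // mulrC.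
have [v33 vlam ve] : [/\ (33 <= v)%N, ((Num.truncn (121 / lam)).+1 <= v)%N
    & ((Num.truncn (2 / e)).+1 <= v)%N].
  by move: Vv; rewrite !geq_max => /andP[-> /andP[-> ->]].
have v33R : 33 <= v%:R :> R by rewrite ler_nat.
have t0 : 0 <= t by rewrite mulr_ge0 ?sqrtr_ge0 // ltW.
have lamv : 121 <= lam * v%:R.
  rewrite mulrC -ler_pdivrMr //; apply: ltW.
  by rewrite -truncn_lt_nat // divr_ge0 // ltW.
have vt : 2048 * v%:R ^+ 2 <= t.
  rewrite -(sqr_sqrtr t0) -/s.
  have : (72 * v%:R) ^+ 2 <= s ^+ 2.
    by apply: lerXn2r; rewrite ?nnegrE ?sqrtr_ge0 ?mulr_ge0 //; lra.
  have := sqr_ge0 (v%:R : R); rewrite exprMn; lra.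
have lnn : ln (n.+1%:R : R) <= lam * v%:R ^+ 4.
  apply: le_trans (lnS_le _ _ n2) _.
  apply: (ln_le_of_cube_dim R b c lam n%:R v b0 c0 lam0 clam).
    by rewrite ler1n ltnW.
  rewrite -/t -/s /b; rewrite -(natr1 v) in sv; lra.
rewrite ger0_norm ?random_subset_prob_ge0 // dE.
apply: le_lt_trans (cube_prob_le_expR _ _ _ _ _ v33 lamv vt lnn) _.
(* The bound 2 exp(-v) is below [e] because 2 / [e] < v < exp(v). *)
have ev : 2 / e < v%:R.
  by rewrite -truncn_lt_nat // divr_ge0 // ltW.
rewrite expRN ltr_pdivrMr ?expR_gt0 // -ltr_pdivrMl // mulrC.
apply: lt_trans ev _; have := expR_ge1Dx (v%:R : R); lra.
Qed.
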